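(* The class $\mathcal{M}$ is closed under multiplication: if $m_1, m_2\in\mathcal{M}$, then the pointwise product $m_1m_2$ belongs to $\mathcal{M}$.
   Context: $\mathcal{M}$ denotes the set of functions $m\in C^2[0,1]$ such that: (C1) $m(s)>0$ for $s>0$ and $m(0)=0$; (C2) $m'(s)>0$ for $s>0$ and $m'(0)=0$; (C3) $m''(s)>0$ for $s>0$; (C4) the function $\frac{m''}{m'}$ is decreasing on $(0,1)$. ''Decreasing'' means strictly decreasing. *)

(* Defs.v *)
From Stdlib Require Export Reals.
Open Scope R_scope.

Definition unit_interval (s : R) : Prop := 0 <= s <= 1.

(* [d] is the derivative on [D] of [f], all difference quotients being taken
   inside [D]: at the end points of an interval it is the one-sided one. *)
Definition derivative_on (D : R -> Prop) (f d : R -> R) : Prop :=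
  forall s, D s -> D_in f d D s.

Definition continuous_on (D : R -> Prop) (f : R -> R) : Prop :=
  forall s, D s -> continue_in f D s.

Definition strictly_decreasing_on (D : R -> Prop) (f : R -> R) : Prop :=
  forall s t, D s -> D t -> s < t -> f t < f s.

(* [m] is in C^2[0,1], with first and second derivatives [m'] and [m''] there.
   Only the values on [0,1] matter; they determine [m'] and [m''] on [0,1].
   Continuity of [m] and [m'] follows from differentiability. *)
Definition C2_01 (m m' m'' : R -> R) : Prop :=
  derivative_on unit_interval m m' /\
  derivative_on unit_interval m' m'' /\
  continuous_on unit_interval m''.

Definition class_M (m : R -> R) : Prop :=
  exists m' m'' : R -> R,
    C2_01 m m' m'' /\
    ((forall s, 0 < s <= 1 -> 0 < m s) /\ m 0 = 0) /\
    ((forall s, 0 < s <= 1 -> 0 < m' s) /\ m' 0 = 0) /\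
    (forall s, 0 < s <= 1 -> 0 < m'' s) /\
    strictly_decreasing_on (fun s => 0 < s < 1) (fun s => m'' s / m' s).

(* Main.v *)
Require Import Defs.
From Stdlib Require Import Reals Lra.
From Coquelicot Require Import Rcomplements.
Open Scope R_scope.

(** For [m] in the class put [p = m'' / m'] and [a = m' / m].  Since [p]
    decreases, [m' - p(s) m] increases on [0,s], so [p <= a]; hence
    [m' - a(s) m] decreases to the right of [s], so [a] decreases.  For the
    product of two members with quotients [p, a] and [q, b], the quotient of
    (C4) is [F = (p a + q b + 2 a b) / (a + b)].  It increases in [p] and [q];
    it increases in [a] because [p - q + 2 b > 0] and in [b] because
    [q - p + 2 a > 0].  All four arguments decrease, so [F] does. *)

(** Retraction of the line onto [0,1]. Precomposing with it turns a function controlled only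
    relative to [0,1] into a total one, continuous at every point of [0,1] and differentiable
    inside, which is what the standard [MVT] asks for. *)
Definition clamp01 (x : R) : R := Rmax 0 (Rmin 1 x).

Lemma clamp01_in (x : R) : unit_interval (clamp01 x).
Proof.
  unfold clamp01, unit_interval, Rmax, Rmin.
  destruct (Rle_dec 1 x), (Rle_dec 0 _); lra.
Qed.

Lemma clamp01_id (x : R) : unit_interval x -> clamp01 x = x.
Proof.
  unfold clamp01, unit_interval, Rmax, Rmin.
  destruct (Rle_dec 1 x), (Rle_dec 0 _); lra.
Qed.

Lemma clamp01_contract (x y : R) : Rabs (clamp01 x - clamp01 y) <= Rabs (x - y).
Proof.
  unfold clamp01, Rmax, Rmin, Rabs.
  destruct (Rle_dec 1 x), (Rle_dec 1 y); repeat destruct (Rle_dec 0 _);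
    repeat destruct (Rcase_abs _); lra.
Qed.

Lemma continuity_clamp01 (f : R -> R) (x : R) :
  continuous_on unit_interval f -> unit_interval x ->
  continuity_pt (fun y => f (clamp01 y)) x.
Proof.
  intros hf hx eps heps.
  destruct (hf x hx eps heps) as [del [hdel h]].
  exists del; split; [exact hdel|].
  intros y [_ hy]; simpl in *; unfold Rdist in *.
  rewrite (clamp01_id x hx).
  (* The limit in [continue_in] ignores the point [x] itself, yet [clamp01 y = x] can hold with [y]
     different from [x] when [x] is an end point. *)
  destruct (Req_dec x (clamp01 y)) as [e|ne].
  - rewrite <- e, Rminus_diag, Rabs_R0; exact heps.
  - apply h; split; [split; [apply clamp01_in | exact ne]|].
    pose proof (clamp01_contract y x) as hc.
    rewrite (clamp01_id x hx) in hc; lra.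
Qed.

Lemma derivable_clamp01 (f d : R -> R) (x : R) :
  derivative_on unit_interval f d -> 0 < x < 1 ->
  derivable_pt_lim (fun y => f (clamp01 y)) x (d x).
Proof.
  intros hf hx eps heps.
  destruct (hf x ltac:(unfold unit_interval; lra) eps heps) as [del [hdel h]].
  simpl in h; unfold Rdist in h.
  (* This radius keeps [x + k] inside [0,1], where clamping changes nothing. *)
  assert (hpos : 0 < Rmin del (Rmin x (1 - x))).
  { repeat apply Rmin_pos; lra. }
  exists (mkposreal _ hpos); simpl; intros k hk0 hk.
  pose proof (Rmin_l del (Rmin x (1 - x))).
  pose proof (Rmin_r del (Rmin x (1 - x))).
  pose proof (Rmin_l x (1 - x)).
  pose proof (Rmin_r x (1 - x)).
  assert (hkx : - x < k < 1 - x) by (split; unfold Rabs in hk; destruct (Rcase_abs k); lra).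
  rewrite !clamp01_id by (unfold unit_interval; lra).
  replace k with (x + k - x) at 2 by ring.
  apply h; split.
  - split; [unfold unit_interval|]; lra.
  - replace (x + k - x) with k by ring; lra.
Qed.

Lemma derivative_on_continuous (f d : R -> R) (D : R -> Prop) :
  derivative_on D f d -> continuous_on D f.
Proof. intros hf s hs; exact (cont_deriv _ _ _ _ (hf s hs)). Qed.

Lemma MVT_unit_interval (f d : R -> R) (a b : R) :
  derivative_on unit_interval f d -> 0 <= a -> a < b -> b <= 1 ->
  exists c, a < c < b /\ f b - f a = d c * (b - a).
Proof.
  intros hf ha hab hb.
  assert (pr1 : forall c, a < c < b -> derivable_pt (fun y => f (clamp01 y)) c).
  { intros c hc; exists (d c); apply derivable_clamp01; [exact hf | lra]. }
  destruct (MVT _ id a b pr1 (fun c _ => derivable_pt_id c) hab) as [c [hc e]].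
  - intros c hc; apply continuity_clamp01;
      [exact (derivative_on_continuous _ _ _ hf) | unfold unit_interval; lra].
  - intros c _; apply derivable_continuous_pt, derivable_pt_id.
  - exists c; split; [exact hc|].
    rewrite derive_pt_id in e; unfold id in e.
    rewrite (derive_pt_eq_0 _ _ (d c)) in e by (apply derivable_clamp01; [exact hf | lra]).
    rewrite !clamp01_id in e by (unfold unit_interval; lra); lra.
Qed.

Lemma derivative_on_mult (D : R -> Prop) (f df g dg : R -> R) :
  derivative_on D f df -> derivative_on D g dg ->
  derivative_on D (fun s => f s * g s) (fun s => df s * g s + f s * dg s).
Proof. intros hf hg s hs; apply Dmult; auto. Qed.

Lemma derivative_on_plus (D : R -> Prop) (f df g dg : R -> R) :
  derivative_on D f df -> derivative_on D g dg ->
  derivative_on D (fun s => f s + g s) (fun s => df s + dg s).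
Proof. intros hf hg s hs; apply Dadd; auto. Qed.

Lemma derivative_on_minus_scal (D : R -> Prop) (f df g dg : R -> R) (c : R) :
  derivative_on D f df -> derivative_on D g dg ->
  derivative_on D (fun s => f s - c * g s) (fun s => df s - c * dg s).
Proof.
  intros hf hg s hs; apply Dminus; [auto|].
  apply (Dmult_const D g dg s c); auto.
Qed.

Lemma continuous_on_plus (D : R -> Prop) (f g : R -> R) :
  continuous_on D f -> continuous_on D g -> continuous_on D (fun s => f s + g s).
Proof. intros hf hg s hs; apply limit_plus; [apply hf | apply hg]; exact hs. Qed.

Lemma continuous_on_mult (D : R -> Prop) (f g : R -> R) :
  continuous_on D f -> continuous_on D g -> continuous_on D (fun s => f s * g s).
Proof. intros hf hg s hs; apply limit_mul; [apply hf | apply hg]; exact hs. Qed.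

Section LogDerivatives.

Variables m m' m'' : R -> R.
Hypothesis hd : derivative_on unit_interval m m'.
Hypothesis hd' : derivative_on unit_interval m' m''.
Hypothesis m0 : m 0 = 0.
Hypothesis m'0 : m' 0 = 0.
Hypothesis m_pos : forall s, 0 < s <= 1 -> 0 < m s.
Hypothesis m'_pos : forall s, 0 < s <= 1 -> 0 < m' s.
Hypothesis hdec :
  strictly_decreasing_on (fun s => 0 < s < 1) (fun s => m'' s / m' s).

Lemma second_quotient_le_first (s : R) : 0 < s < 1 -> m'' s / m' s <= m' s / m s.
Proof.
  intros hs; set (p := m'' s / m' s).
  (* With [p] frozen at its value at [s], [m' - p * m] vanishes at 0 and has positive slope at
     [c < s]. *)
  destruct (MVT_unit_interval _ _ 0 s (derivative_on_minus_scal _ _ _ _ _ p hd' hd))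
    as [c [hc e]]; try lra.
  assert (hp : p < m'' c / m' c) by (apply (hdec c s); lra).
  clearbody p.
  assert (hm'c : 0 < m' c) by (apply m'_pos; lra).
  assert (hms : 0 < m s) by (apply m_pos; lra).
  apply Rlt_div_r in hp; [|exact hm'c].
  apply Rle_div_r; [exact hms|].
  rewrite m0, m'0 in e.
  assert (0 <= (m'' c - p * m' c) * (s - 0)) by (apply Rmult_le_pos; lra).
  lra.
Qed.

Lemma first_quotient_decreasing (s t : R) :
  0 < s -> s < t -> t < 1 -> m' t / m t <= m' s / m s.
Proof.
  intros hs hst ht; set (a := m' s / m s).
  (* By the choice of [a], [m' - a * m] vanishes at [s]; its slope at [c > s] is negative because
     the quotient [m'' / m'] has dropped below its value at [s], itself at most [a]. *)
  destruct (MVT_unit_interval _ _ s t (derivative_on_minus_scal _ _ _ _ _ a hd' hd))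
    as [c [hc e]]; try lra.
  assert (hp : m'' c / m' c < m'' s / m' s) by (apply (hdec s c); lra).
  assert (hpa : m'' s / m' s <= a) by (apply second_quotient_le_first; lra).
  assert (hm'c : 0 < m' c) by (apply m'_pos; lra).
  assert (hms : 0 < m s) by (apply m_pos; lra).
  assert (hmt : 0 < m t) by (apply m_pos; lra).
  assert (ha : m' s - a * m s = 0) by (unfold a; field; lra).
  clearbody a.
  assert (hca : m'' c / m' c < a) by lra.
  apply Rlt_div_l in hca; [|exact hm'c].
  apply Rle_div_l; [exact hmt|].
  assert (0 <= (a * m' c - m'' c) * (t - s)) by (apply Rmult_le_pos; lra).
  lra.
Qed.

End LogDerivatives.

(** This is (m1 m2)'' / (m1 m2)' with both parts divided by m1 m2; m1'' / m1 becomes [p * a], and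
    m2'' / m2 becomes [q * b]. *)
Definition product_quotient (p a q b : R) : R :=
  (p * a + q * b + 2 * (a * b)) / (a + b).

Lemma product_quotient_sym (p a q b : R) :
  product_quotient p a q b = product_quotient q b p a.
Proof.
  unfold product_quotient; f_equal; ring.
Qed.

(** As a function of [a] this is the homography (a (p + 2 b) + q b) / (a + b), of determinant b (p -
    q + 2 b). *)
Lemma product_quotient_le_first (p a1 a2 q b : R) :
  0 < a2 -> a2 <= a1 -> 0 < b -> 0 <= p - q + 2 * b ->
  product_quotient p a2 q b <= product_quotient p a1 q b.
Proof.
  intros ha2 ha hb hpq; unfold product_quotient.
  apply Rminus_le_0.
  replace (_ - _) with
    ((a1 - a2) * (b * (p - q + 2 * b)) * / ((a1 + b) * (a2 + b))) by (field; lra).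
  repeat apply Rmult_le_pos; try lra.
  left; apply Rinv_0_lt_compat, Rmult_lt_0_compat; lra.
Qed.

(** The order of the moves matters: [p2 <= a2] and [q2 <= b2] bound only the smaller values, so [a]
    and [b] are raised while [p] and [q] stay at [p2] and [q2]. Strictness comes from the last move,
    where [p] and [q] have positive weights [a1] and [b1]. *)
Lemma product_quotient_lt (p1 p2 a1 a2 q1 q2 b1 b2 : R) :
  0 < a2 -> a2 <= a1 -> 0 < b2 -> b2 <= b1 ->
  0 < p2 -> p2 < p1 -> 0 < q2 -> q2 < q1 -> p2 <= a2 -> q2 <= b2 ->
  product_quotient p2 a2 q2 b2 < product_quotient p1 a1 q1 b1.
Proof.
  intros.
  apply Rle_lt_trans with (product_quotient p2 a1 q2 b2).
  { apply product_quotient_le_first; lra. }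
  apply Rle_lt_trans with (product_quotient p2 a1 q2 b1).
  (* Symmetry turns the move in [b] into one in the first quotient; the sign condition follows from
     [p2 <= a2 <= a1]. *)
  { rewrite !(product_quotient_sym p2); apply product_quotient_le_first; lra. }
  unfold product_quotient, Rdiv; apply Rmult_lt_compat_r.
  { apply Rinv_0_lt_compat; lra. }
  assert (p2 * a1 < p1 * a1) by (apply Rmult_lt_compat_r; lra).
  assert (q2 * b1 < q1 * b1) by (apply Rmult_lt_compat_r; lra).
  lra.
Qed.

Theorem corollary1 (m1 m2 : R -> R) (hm1 : class_M m1) (hm2 : class_M m2) :
  class_M (fun s => m1 s * m2 s).
Proof.
  destruct hm1 as (f' & f'' & (df & df' & cf) & (fp & f0) & (fp' & f'0) & fp'' & fdec).
  destruct hm2 as (g' & g'' & (dg & dg' & cg) & (gp & g0) & (gp' & g'0) & gp'' & gdec).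
  exists (fun s => f' s * m2 s + m1 s * g' s),
    (fun s => (f'' s * m2 s + f' s * g' s) + (f' s * g' s + m1 s * g'' s)).
  pose proof (derivative_on_continuous _ _ _ df).
  pose proof (derivative_on_continuous _ _ _ df').
  pose proof (derivative_on_continuous _ _ _ dg).
  pose proof (derivative_on_continuous _ _ _ dg').
  repeat split.
  - apply derivative_on_mult; assumption.
  - apply derivative_on_plus; apply derivative_on_mult; assumption.
  - repeat apply continuous_on_plus; apply continuous_on_mult; assumption.
  - intros s hs; apply Rmult_lt_0_compat; auto.
  - rewrite f0; ring.
  - intros s hs; apply Rplus_lt_0_compat; apply Rmult_lt_0_compat; auto.
  - rewrite f0, f'0; ring.
  - intros s hs; repeat apply Rplus_lt_0_compat; apply Rmult_lt_0_compat; auto.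
  - assert (E : forall s, 0 < s < 1 ->
      (f'' s * m2 s + f' s * g' s + (f' s * g' s + m1 s * g'' s)) /
        (f' s * m2 s + m1 s * g' s) =
      product_quotient (f'' s / f' s) (f' s / m1 s) (g'' s / g' s) (g' s / m2 s)).
    { intros s hs; assert (hs' : 0 < s <= 1) by lra.
      specialize (fp s hs'); specialize (fp' s hs').
      specialize (gp s hs'); specialize (gp' s hs').
      (* These make the denominator [f' s * m2 s + m1 s * g' s] nonzero, a side condition of [field]
         that [lra] cannot get from the factors alone. *)
      assert (0 < f' s * m2 s) by (apply Rmult_lt_0_compat; assumption).
      assert (0 < m1 s * g' s) by (apply Rmult_lt_0_compat; assumption).
      unfold product_quotient; field; repeat split; lra. }
    intros s t hs ht hst; rewrite !E by assumption.
    assert (ht' : 0 < t <= 1) by lra.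
    apply product_quotient_lt; try (apply Rdiv_lt_0_compat; auto).
    + apply (first_quotient_decreasing m1 f' f''); auto; lra.
    + apply (first_quotient_decreasing m2 g' g''); auto; lra.
    + apply fdec; assumption.
    + apply gdec; assumption.
    + apply (second_quotient_le_first m1 f' f''); auto.
    + apply (second_quotient_le_first m2 g' g''); auto.
Qed.
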